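(* Let $\alpha,\beta>0$ and consider the Hamiltonian test problem $\frac{dQ}{dt}=\frac{P}{\beta^2}$, $\frac{dP}{dt}=-\frac{Q}{\alpha^2}$ with Hamiltonian $H(Q,P)=\frac12\left(\frac{Q^2}{\alpha^2}+\frac{P^2}{\beta^2}\right)$. Consider a symplectic and momentum flip-reversible integrator with step size $h>0$ which, when applied to this problem, can be expressed as $\mathbf{Y}_{n+1}=\mathcal{M}_2^{(h,\sigma)}\,\mathbf{Y}_n$, where $\mathbf{Y}_n=[Q_n,P_n]^T$, $\sigma=\beta/\alpha$ and $$\mathcal{M}_2^{(h,\sigma)}=\begin{bmatrix} \mathrm{p}_h & \mathrm{e}_h+\sigma^{-1}\mathrm{q}_h\\ \mathrm{e}_h-\sigma\,\mathrm{q}_h & \mathrm{p}_h\end{bmatrix},\qquad \det \mathcal{M}_2^{(h,\sigma)}=1,$$ with real numbers $\mathrm{p}_h,\mathrm{q}_h,\mathrm{e}_h$. If $\mathrm{e}_h=0$, then the integrator preserves the Hamiltonian, i.e. $H(\mathbf{Y}_{n+1})=H(\mathbf{Y}_n)$ for every $\mathbf{Y}_n\in\mathbb{R}^2$.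
   Context: For a linear map of $\mathbb{R}^2$, symplectic means determinant $1$. A map $\Psi$ on phase space is momentum flip-reversible if $\Psi(Q,P)=(Q',P')$ if and only if $\Psi(Q',-P')=(Q,-P)$. The linear integrators considered are those whose real $2\times 2$ matrix $\mathcal{M}_2^{(h,\sigma)}$ has equal diagonal entries and determinant $1$. Writing $M_{ij}$ for its entries, one sets $\mathrm{p}_h=M_{11}=M_{22}$, $\mathrm{q}_h=\frac{\sigma}{\sigma^2+1}(M_{12}-M_{21})$, $\mathrm{e}_h=\frac{1}{\sigma^2+1}(\sigma^2M_{12}+M_{21})$, which gives the displayed form of the matrix. *)

(* Defs.v *)
From HB Require Import structures.
From mathcomp Require Import all_boot all_order all_algebra.
From mathcomp Require Import reals.

Set Implicit Arguments.
Unset Strict Implicit.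
Unset Printing Implicit Defensive.

Import Order.TTheory GRing.Theory Num.Theory.
Local Open Scope ring_scope.

(* A phase-space point [Q, P]^T is a column vector: entry 0 is the position Q,
   entry 1 the momentum P. *)
Definition state (R : realType) (Q P : R) : 'cV[R]_2 :=
  \col_(i < 2) if i == 0 then Q else P.

Definition position (R : realType) (Y : 'cV[R]_2) : R := Y 0 0.
Definition momentum (R : realType) (Y : 'cV[R]_2) : R := Y 1 0.

Definition mx22 (R : realType) (a b c d : R) : 'M[R]_2 :=
  \matrix_(i < 2, j < 2)
    if i == 0 then (if j == 0 then a else b) else (if j == 0 then c else d).

Definition hamiltonian (R : realType) (alpha beta : R) (Y : 'cV[R]_2) : R :=
  2^-1 * (position Y ^+ 2 / alpha ^+ 2 + momentum Y ^+ 2 / beta ^+ 2).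

(* Right-hand side of the system dQ/dt = P / beta^2, dP/dt = - Q / alpha^2. *)
Definition test_field (R : realType) (alpha beta : R) (Y : 'cV[R]_2) :
    'cV[R]_2 :=
  state (momentum Y / beta ^+ 2) (- position Y / alpha ^+ 2).

(* A one-step method: [Psi h f] is the map Y_n |-> Y_(n+1) obtained by applying
   the method with step size h to the problem dY/dt = f(Y). *)
Definition integrator (R : realType) : Type :=
  R -> ('cV[R]_2 -> 'cV[R]_2) -> 'cV[R]_2 -> 'cV[R]_2.

Definition linear_symplectic (R : realType) (Phi : 'cV[R]_2 -> 'cV[R]_2) :
    Prop :=
  exists2 A : 'M[R]_2, (forall Y, Phi Y = A *m Y) & \det A = 1.

Definition momentum_flip_reversible (R : realType)
    (Phi : 'cV[R]_2 -> 'cV[R]_2) : Prop :=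
  forall Q P Q' P' : R,
    Phi (state Q P) = state Q' P' <-> Phi (state Q' (- P')) = state Q (- P).

Definition M2 (R : realType) (sigma p q e : R) : 'M[R]_2 :=
  mx22 p                 (e + sigma^-1 * q)
       (e - sigma * q)   p.

(* Main.v *)
(* In the scaled variables Q / alpha, P / beta, the matrix with [e_h = 0] has
   rows [(p_h, q_h)] and [(- q_h, p_h)], so it multiplies the squared Euclidean
   norm by [p_h ^+ 2 + q_h ^+ 2], which is its determinant; and H is half that
   squared norm. *)
Require Import Defs.
From HB Require Import structures.
From mathcomp Require Import all_boot all_order all_algebra.
From mathcomp Require Import reals ring.

Set Implicit Arguments.
Unset Strict Implicit.
Unset Printing Implicit Defensive.

Import Order.TTheory GRing.Theory Num.Theory.
Local Open Scope ring_scope.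

Lemma position_M2 (R : realType) (sigma p q e : R) (Y : 'cV[R]_2) :
  position (M2 sigma p q e *m Y)
    = p * position Y + (e + sigma^-1 * q) * momentum Y.
Proof.
rewrite /position /momentum mxE big_ord_recl big_ord1 !mxE /=.
(* Splitting the sum leaves the second index as [lift ord0 ord0], which agrees with [1] in value,
   hence [val_inj]. *)
by rewrite (_ : lift ord0 ord0 = 1) //; apply: val_inj.
Qed.

Lemma momentum_M2 (R : realType) (sigma p q e : R) (Y : 'cV[R]_2) :
  momentum (M2 sigma p q e *m Y)
    = (e - sigma * q) * position Y + p * momentum Y.
Proof.
rewrite /momentum /position mxE big_ord_recl big_ord1 !mxE /=.
by rewrite (_ : lift ord0 ord0 = 1) //; apply: val_inj.
Qed.

Lemma det_M2E (R : realType) (sigma p q e : R) :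
  \det (M2 sigma p q e) = p ^+ 2 - (e + sigma^-1 * q) * (e - sigma * q).
Proof.
rewrite (expand_det_row _ 0) big_ord_recl big_ord1 /cofactor !det_mx11 !mxE /=.
by ring.
Qed.

(** With [sigma = beta / alpha], the two squares contribute cross terms in position times momentum
    with coefficients [2 p q / (alpha beta)] and its opposite, which cancel. *)
Lemma hamiltonian_M2 (R : realType) (alpha beta p q : R) (Y : 'cV[R]_2) :
  alpha != 0 -> beta != 0 ->
  hamiltonian alpha beta (M2 (beta / alpha) p q 0 *m Y)
    = \det (M2 (beta / alpha) p q 0) * hamiltonian alpha beta Y.
Proof.
move=> alpha_neq0 beta_neq0.
rewrite /hamiltonian position_M2 momentum_M2 det_M2E.
by field; rewrite alpha_neq0 beta_neq0.
Qed.

Theorem theorem3p1 (R : realType) (alpha beta : R)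
    (alpha_gt0 : 0 < alpha) (beta_gt0 : 0 < beta)
    (sigma : R) (sigmaE : sigma = beta / alpha)
    (h : R) (h_gt0 : 0 < h)
    (Psi : integrator R)
    (Psi_symplectic : linear_symplectic (Psi h (test_field alpha beta)))
    (Psi_reversible : momentum_flip_reversible (Psi h (test_field alpha beta)))
    (p_h q_h e_h : R)
    (PsiE : forall Y : 'cV[R]_2,
      Psi h (test_field alpha beta) Y = M2 sigma p_h q_h e_h *m Y)
    (det_M2 : \det (M2 sigma p_h q_h e_h) = 1) :
  e_h = 0 ->
  forall Y : 'cV[R]_2,
    hamiltonian alpha beta (Psi h (test_field alpha beta) Y)
      = hamiltonian alpha beta Y.
Proof.
(* The determinant condition goes into the goal so that [sigma] and [e_h] are replaced there too,
   matching the factor in [hamiltonian_M2]. *)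
move=> e0 Y; move: det_M2; rewrite PsiE sigmaE e0 => det1.
by rewrite hamiltonian_M2 ?gt_eqF // det1 mul1r.
Qed.
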